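(* Let $G=(V,E)$ be a simple undirected graph and let $A\subseteq V$, $|A|\ge 6$, be an anti-hole in $G$. Then the inequality $$\sum_{i\in A}x_i\le\left\lfloor\frac{|A|}{2}\right\rfloor$$ is valid for $\mathscr{P}_{IUC}(G)$. Furthermore, it induces a facet of $\mathscr{P}_{IUC}(G[A])$ if and only if $|A|$ is odd.
   Context: All graphs are finite, simple and undirected. A subset $U\subseteq V$ of the vertices of $G=(V,E)$ is an independent union of cliques (IUC) if every connected component of the induced subgraph $G[U]$ is a complete graph (equivalently, $G[U]$ has no induced path on three vertices). The IUC polytope $\mathscr{P}_{IUC}(G)\subseteq\mathbb{R}^{V}$ is the convex hull of the incidence vectors of all IUCs of $G$. An anti-hole in $G$ is a subset $A\subseteq V$ with $|A|\ge 4$ such that the (edge) complement of $G[A]$ is a chordless cycle. *)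

(* Defs.v *)
From mathcomp Require Import all_boot all_order all_algebra.

Set Implicit Arguments.
Unset Strict Implicit.
Unset Printing Implicit Defensive.

Import Order.TTheory GRing.Theory Num.Theory.
Local Open Scope ring_scope.

Record sgraph := SGraph {
  vertex :> finType;
  adj : rel vertex;
  adj_sym : symmetric adj;
  adj_irr : irreflexive adj
}.

Section Graphs.
Variable G : sgraph.

(* G[A], living on the subtype of A, so that its polytope lives in R^A *)
Definition induced_adj (A : {set G}) : rel {x : G | x \in A} :=
  fun x y => adj (val x) (val y).
Arguments induced_adj : clear implicits.

Lemma induced_adj_sym A : symmetric (induced_adj A).
Proof. by move=> x y; apply: adj_sym. Qed.

Lemma induced_adj_irr A : irreflexive (induced_adj A).
Proof. by move=> x; apply: adj_irr. Qed.

Definition induced (A : {set G}) : sgraph :=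
  SGraph (induced_adj_sym (A := A)) (induced_adj_irr (A := A)).

Definition compl_adj : rel G := fun x y => (x != y) && ~~ adj x y.

Lemma compl_adj_sym : symmetric compl_adj.
Proof. by move=> x y; rewrite /compl_adj eq_sym adj_sym. Qed.

Lemma compl_adj_irr : irreflexive compl_adj.
Proof. by move=> x; rewrite /compl_adj eqxx. Qed.

Definition compl : sgraph := SGraph compl_adj_sym compl_adj_irr.

Definition clique (K : {set G}) : Prop :=
  {in K &, forall x y, x != y -> adj x y}.

Definition component (x : G) : {set G} := [set y | connect (@adj G) x y].

(* G itself is a chordless cycle: c lists all its vertices in cyclic order, and
   the last clause excludes chords. *)
Definition chordless_cycle : Prop :=
  exists c : seq G,
    [/\ (3 <= size c)%N, ucycle (@adj G) c, forall x : G, x \in c &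
        forall x y : G, adj x y -> y = next c x \/ x = next c y].

End Graphs.

Definition IUC (G : sgraph) (U : {set G}) : Prop :=
  forall x : induced U, clique (component x).

Definition antihole (G : sgraph) (A : {set G}) : Prop :=
  (4 <= #|A|)%N /\ chordless_cycle (compl (induced A)).

(* R^o is the field R seen as a module over itself; it gives {ffun I -> R^o},
   i.e. R^I, its vector space structure. *)
Section Polyhedra.
Variables (R : realFieldType) (I : finType).
Implicit Types S : {ffun I -> R^o} -> Prop.

Definition convex_hull S (x : {ffun I -> R^o}) : Prop :=
  exists (n : nat) (p : 'I_n -> {ffun I -> R^o}) (w : 'I_n -> R),
    [/\ forall i, S (p i), forall i, 0 <= w i, \sum_i w i = 1 &
        x = \sum_i w i *: p i].

Definition affinely_independent (n : nat) (p : 'I_n -> {ffun I -> R^o}) : Prop :=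
  forall w : 'I_n -> R,
    \sum_i w i = 0 -> \sum_i w i *: p i = 0 -> forall i, w i = 0.

(* Affine dimension as a relation; only nonempty sets have a dimension. *)
Definition has_dim S (d : nat) : Prop :=
  (exists p : 'I_d.+1 -> {ffun I -> R^o},
     (forall i, S (p i)) /\ affinely_independent p) /\
  (forall n (p : 'I_n -> {ffun I -> R^o}),
     (forall i, S (p i)) -> affinely_independent p -> (n <= d.+1)%N).

Definition valid_ineq S (a : I -> R) (b : R) : Prop :=
  forall x, S x -> \sum_i a i * x i <= b.

Definition facet_ineq S (a : I -> R) (b : R) : Prop :=
  valid_ineq S a b /\
  exists d : nat,
    has_dim S d.+1 /\ has_dim (fun x => S x /\ \sum_i a i * x i = b) d.

End Polyhedra.

Definition incidence (R : realFieldType) (I : finType) (U : {set I}) :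
  {ffun I -> R^o} := [ffun i => (i \in U)%:R].

Definition IUC_polytope (R : realFieldType) (G : sgraph) :
    {ffun G -> R^o} -> Prop :=
  convex_hull (fun x => exists2 U : {set G}, IUC U & x = incidence R U).

Arguments IUC_polytope R G _ : clear implicits.

(* Main.v *)
Require Import Defs.
From mathcomp Require Import all_boot all_order all_algebra.
From mathcomp Require Import zify.
Import Order.TTheory GRing.Theory Num.Theory.
Local Open Scope ring_scope.

(** The complement of [G[A]] is a cycle; let [s] be its rotation and [n = #|A|]. An
IUC of [G[A]] is either a stable set of this cycle, which is disjoint from its
rotation and so has at most [n / 2] elements, or contains two consecutive
vertices, which forces every other element to be next to one of them and leaves
at most 3 elements. For odd [n], the [n] rotations of a maximum stable set are
linearly independent. For even [n], the maximum IUCs all satisfy one further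
homogeneous linear equation, so that the face has dimension less than [n - 1]. *)

Set Implicit Arguments.
Unset Strict Implicit.
Unset Printing Implicit Defensive.

(** * Independence of points and faces of convex hulls *)

Section LinearAlgebra.
Variables (R : realFieldType) (I : finType).
Implicit Types (S : {ffun I -> R^o} -> Prop) (a : I -> R) (b : R).

Definition linearly_independent m (p : 'I_m -> {ffun I -> R^o}) : Prop :=
  forall w : 'I_m -> R, \sum_i w i *: p i = 0 -> forall i, w i = 0.

Lemma sum_scale_ffunE (K : finType) (w : K -> R) (p : K -> {ffun I -> R^o}) j :
  (\sum_i w i *: p i) j = \sum_i w i * p i j.
Proof. by rewrite sum_ffunE; apply: eq_bigr => i _; rewrite ffunE. Qed.

Lemma dot_sum (K : finType) (w : K -> R) (p : K -> {ffun I -> R^o}) a :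
  \sum_j a j * (\sum_i w i *: p i) j = \sum_i w i * \sum_j a j * p i j.
Proof.
under eq_bigr => j _ do rewrite sum_scale_ffunE mulr_sumr.
rewrite exchange_big /=; apply: eq_bigr => i _; rewrite mulr_sumr.
by apply: eq_bigr => j _; rewrite mulrCA.
Qed.

Lemma linearly_independent_row_free m (p : 'I_m -> {ffun I -> R^o}) :
  linearly_independent p ->
  row_free (\matrix_(i < m, j < #|I|) (p i (enum_val j) : R)).
Proof.
move=> pI; apply: inj_row_free => v /rowP v0; apply/rowP => i; rewrite mxE.
apply: (pI (fun i => v 0 i)); apply/ffunP => j.
rewrite sum_scale_ffunE ffunE; have := v0 (enum_rank j); rewrite !mxE; apply: etrans.
by apply: eq_bigr => l _; rewrite mxE enum_rankK.
Qed.

Lemma linearly_independent_leq m (p : 'I_m -> {ffun I -> R^o}) :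
  linearly_independent p -> (m <= #|I|)%N.
Proof.
by move=> /linearly_independent_row_free /eqP <-; apply: rank_leq_col.
Qed.

(** If [m = #|I|], the matrix of the points has a left inverse; as it kills the column of [f], this
    column would be 0. *)
Lemma linearly_independent_ltn m (p : 'I_m -> {ffun I -> R^o}) (f : I -> R) u :
    f u != 0 -> (forall i, \sum_j f j * p i j = 0) ->
  linearly_independent p -> (m < #|I|)%N.
Proof.
move=> fu f0 pI; rewrite ltn_neqAle (linearly_independent_leq pI) andbT.
apply: contraNN fu => /eqP mI.
have /eqP rkM := linearly_independent_row_free pI.
have /row_fullP[B BM] : row_full (\matrix_(i < m, j < #|I|) (p i (enum_val j) : R)).
  by rewrite /row_full rkM mI.
pose F : 'cV[R]_#|I| := \col_j f (enum_val j).
have F0 : F = 0.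
  rewrite -[F]mul1mx -BM -mulmxA; set MF := _ *m F.
  suff -> : MF = 0 by rewrite mulmx0.
  apply/colP => i; rewrite !mxE; apply: etrans (f0 i).
  rewrite [RHS](big_enum_val (A := I)) /=.
  by apply: eq_bigr => j _; rewrite !mxE mulrC.
have /colP/(_ (enum_rank u)) := F0.
by rewrite !mxE enum_rankK => ->.
Qed.

(** Applying [a] to a vanishing combination gives [b] times the sum of its weights, which is thus
    0. *)
Lemma affinely_independent_hyperplane m (p : 'I_m -> {ffun I -> R^o}) a b :
    b != 0 -> (forall i, \sum_j a j * p i j = b) ->
  affinely_independent p -> linearly_independent p.
Proof.
move=> b0 pb pA w wp; apply: pA => //; apply/eqP.
have /eqP := dot_sum w p a; rewrite wp big1 => [|j _]; last first.
  by rewrite ffunE mulr0.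
under eq_bigr => i _ do rewrite pb.
by rewrite -mulr_suml eq_sym mulf_eq0 (negPf b0) orbF.
Qed.

Lemma affinely_independent_ord (K : finType) S (q : K -> {ffun I -> R^o}) m :
    #|K| = m -> (forall k, S (q k)) ->
    (forall w : K -> R, \sum_k w k = 0 -> \sum_k w k *: q k = 0 ->
       forall k, w k = 0) ->
  exists p : 'I_m -> {ffun I -> R^o},
    (forall i, S (p i)) /\ affinely_independent p.
Proof.
move=> <- Sq qA; exists (fun i => q (enum_val i)); split=> // w w0 wq i.
rewrite -[i]enum_valK; apply: (qA (fun k => w (enum_rank k))).
  by rewrite -[RHS]w0 [RHS](reindex _ (onW_bij _ (enum_rank_bij K))).
apply: etrans wq; rewrite [RHS](reindex _ (onW_bij _ (enum_rank_bij K))).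
by apply: eq_bigr => k _; rewrite enum_rankK.
Qed.

Lemma convex_hull_sub S x : S x -> convex_hull S x.
Proof.
move=> Sx; exists 1%N, (fun=> x), (fun=> 1).
by split=> //; rewrite big_ord1 ?scale1r.
Qed.

Lemma convex_hull_valid S a b : valid_ineq S a b -> valid_ineq (convex_hull S) a b.
Proof.
move=> Sab x [n] [p] [w] [Sp w0 w1 ->]; rewrite dot_sum.
rewrite -[b]mul1r -w1 mulr_suml; apply: ler_sum => i _.
by rewrite ler_wpM2l // Sab.
Qed.

(** The weighted slacks are nonnegative and sum to 0, so only generators on the face carry positive
    weight. *)
Lemma convex_hull_face S a b (f : I -> R) :
    valid_ineq S a b ->
    (forall x, S x -> \sum_i a i * x i = b -> \sum_i f i * x i = 0) ->
  forall x, convex_hull S x -> \sum_i a i * x i = b -> \sum_i f i * x i = 0.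
Proof.
move=> Sab Sf x [n] [p] [w] [Sp w0 w1 ->]; rewrite !dot_sum => ab.
have : \sum_i w i * (b - \sum_j a j * p i j) == 0.
  by under eq_bigr do rewrite mulrBr; rewrite sumrB -mulr_suml w1 mul1r ab subrr.
rewrite psumr_eq0 => [/allP wb|i _]; last by rewrite mulr_ge0 // subr_ge0 Sab.
apply: big1 => i _; have := wb i; rewrite mem_index_enum mulf_eq0 subr_eq0.
by case/(_ isT)/orP=> /eqP e; [rewrite e mul0r | rewrite Sf ?mulr0].
Qed.

End LinearAlgebra.

Lemma affinely_independent_leq (R : realFieldType) (I : finType) m
    (p : 'I_m -> {ffun I -> R^o}) :
  affinely_independent p -> (m <= #|I|.+1)%N.
Proof.
(* Lift the points to the hyperplane [x None = 1] of [R^(option I)]. *)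
move=> pA; rewrite -card_option.
pose q i : {ffun option I -> R^o} := [ffun o => if o is Some j then p i j else 1].
apply: (@linearly_independent_leq _ _ _ q) => w wq; apply: pA.
  have /ffunP/(_ None) := wq; rewrite sum_scale_ffunE ffunE; apply: etrans.
  by apply: eq_bigr => i _; rewrite ffunE mulr1.
apply/ffunP => j; have /ffunP/(_ (Some j)) := wq.
rewrite !sum_scale_ffunE !ffunE; apply: etrans.
by apply: eq_bigr => i _; rewrite ffunE.
Qed.

(** * IUCs and the dimension of their polytope *)

Section IUC.
Variables (R : realFieldType) (G : sgraph).

Lemma IUCP (U : {set G}) :
  IUC U <-> {in U & &, forall x y z, adj x y -> adj y z -> x != z -> adj x z}.
Proof.
split=> [UI x y z xU yU zU xy yz xz|UP x].
  pose v t (tU : t \in U) : induced U := exist _ t tU.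
  have := UI (v y yU) (v x xU) (v z zU); rewrite !inE; apply=> //.
    by apply: connect1; rewrite /= /induced_adj adj_sym.
  exact: connect1.
(* Without induced paths on three vertices, adjacency to [x] propagates along any path from [x]. *)
have xC : forall y, connect (@adj (induced U)) x y -> x != y -> adj x y.
  move=> y /connectP[p]; elim/last_ind: p y => [|p z IHp] y /=.
    by move=> _ ->; rewrite eqxx.
  rewrite rcons_path last_rcons => /andP[xp lz] ->.
  have [e _|xl xz] := eqVneq x (last x p); first by rewrite {1}e.
  exact: UP (valP x) (valP (last x p)) (valP z) (IHp _ xp erefl xl) lz xz.
move=> y z; rewrite !inE => xy xz yz.
have [e|xy'] := eqVneq x y; first by rewrite -e in yz *; exact: xC.
have [e|xz'] := eqVneq x z.
  by rewrite -e adj_sym; apply: xC => //; rewrite e eq_sym.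
apply: (UP _ _ _ (valP y) (valP x) (valP z)) => //; last exact: xC.
by rewrite adj_sym; apply: xC.
Qed.

Lemma dot_incidence (T : finType) (a : T -> R) (U : {set T}) :
  \sum_i a i * incidence R U i = \sum_(i in U) a i.
Proof.
rewrite [RHS]big_mkcond; apply: eq_bigr => i _.
by rewrite ffunE; case: ifP; rewrite ?mulr1 ?mulr0.
Qed.

Lemma dot1_incidence (T : finType) (U : {set T}) :
  \sum_i 1 * incidence R U i = #|U|%:R.
Proof. by rewrite dot_incidence sumr_const. Qed.

Lemma IUC_set0 : IUC (set0 : {set G}).
Proof. by apply/IUCP => x y z; rewrite inE. Qed.

Lemma IUC_set1 (x : G) : IUC [set x].
Proof.
by apply/IUCP => y z t /set1P-> /set1P-> /set1P->; rewrite adj_irr.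
Qed.

(** The empty set and the singletons give [#|G|.+1] affinely independent points. *)
Lemma IUC_polytope_dim : has_dim (IUC_polytope R G) #|G|.
Proof.
split=> [|m p _]; last exact: affinely_independent_leq.
pose q (o : option G) := incidence R (if o is Some t then [set t] else set0).
apply: (affinely_independent_ord (q := q)); first exact: card_option.
  by move=> k; apply: convex_hull_sub; eexists; last reflexivity;
     case: k => [t|]; [apply: IUC_set1|apply: IUC_set0].
move=> w w0 wq.
have wS t : w (Some t) = 0.
  have /ffunP/(_ t) := wq; rewrite sum_scale_ffunE ffunE (bigD1 (Some t)) //=.
  rewrite ffunE set11 mulr1 big1 ?addr0 // => -[k|] kt; rewrite ffunE ?inE ?mulr0 //.
  by have /negPf -> : t != k; [apply: contraNneq kt => -> | rewrite mulr0].
by case=> //; move: w0; rewrite (bigD1 None) //= big1 ?addr0 // => -[k|].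
Qed.

Lemma has_dim_uniq (I : finType) (S : {ffun I -> R^o} -> Prop) d e :
  has_dim S d -> has_dim S e -> d = e.
Proof.
move=> [[p [Sp pA]] dm] [[q [Sq qA]] em].
by apply/eqP; rewrite eqn_leq; apply/andP; split; [exact: em Sp pA|exact: dm Sq qA].
Qed.

End IUC.

(** * Permutations that form a single cycle *)

Section CyclicShift.
Variables (T : finType) (s : T -> T).
Hypotheses (s_inj : injective s) (s_order : forall x, order s x = #|T|).

Lemma iter_shift_card x : iter #|T| s x = x.
Proof. by rewrite -(s_order x) iter_order. Qed.

Lemma iter_shift_inj i : injective (iter i s).
Proof. by elim: i => [|i IHi] x y //= /s_inj /IHi. Qed.

Lemma iter_shift_ex x y : exists2 i, (i < #|T|)%N & y = iter i s x.
Proof.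
have xy : fconnect s x y.
  have /subset_cardP := s_order x; rewrite /order => /(_ (subset_predT _)) e.
  by have := e y; rewrite inE.
exists (findex s x y); last by rewrite iter_findex.
by rewrite -(s_order x) findex_max.
Qed.

Lemma iter_shift_eq x i j : (i < #|T|)%N -> (j < #|T|)%N ->
  (iter i s x == iter j s x) = (i == j).
Proof.
rewrite -(s_order x) => iT jT; apply/eqP/eqP => [|-> //].
by move=> e; rewrite -(findex_iter iT) e findex_iter.
Qed.

Lemma iterS_shift_eq x i : (i < #|T|)%N -> (x == iter i.+1 s x) = (i.+1 == #|T|).
Proof.
move=> iT; have [->|iT'] := eqVneq i.+1 #|T|; first by rewrite iter_shift_card eqxx.
rewrite -[x in x == _]/(iter 0 s x) iter_shift_eq //; lia.
Qed.

Lemma disjoint_shift_card (W : {set T}) i :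
  {in W, forall x, iter i s x \notin W} -> (#|W|.*2 <= #|T|)%N.
Proof.
move=> Wi; have <- : #|W :|: iter i s @: W| = #|W|.*2.
  rewrite cardsU card_imset ?addnn; last exact: iter_shift_inj.
  suff -> : W :&: iter i s @: W = set0 by rewrite cards0 subn0.
  apply/setP => y; rewrite !inE; apply/andP => -[yW /imsetP[x xW yx]].
  by have := Wi _ xW; rewrite -yx yW.
exact: max_card.
Qed.

(** The image of [W] under [iter i s] is disjoint from [W] and as large as its complement, hence
    equal to it. *)
Lemma disjoint_shift_half (W : {set T}) i x :
    {in W, forall y, iter i s y \notin W} -> #|W|.*2 = #|T| ->
  (iter i s x \in W) = (x \notin W).
Proof.
move=> Wi W2; have [xW|xW] /= := boolP (x \in W); first by apply/negbTE/Wi.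
apply/negPn/negP => ixW.
have iW : iter i s @: W \subset ~: W.
  by apply/subsetP => _ /imsetP[y yW ->]; rewrite inE Wi.
have /eqP e : iter i s @: W == ~: W.
  rewrite eqEcard iW card_imset; last exact: iter_shift_inj.
  by rewrite cardsCs setCK -W2 -addnn addnK /=.
have : iter i s x \in iter i s @: W by rewrite e inE.
by rewrite mem_imset ?(negPf xW) //; apply: iter_shift_inj.
Qed.

End CyclicShift.

(** * IUCs in the complement of a cycle *)

Section CyclicComplement.
Variables (R : realFieldType) (H : sgraph) (s : H -> H).
Hypotheses (s_inj : injective s) (s_order : forall x, order s x = #|H|).
Hypothesis adjE : forall x y : H, adj x y = [&& x != y, y != s x & x != s y].
Hypothesis H6 : (6 <= #|H|)%N.

(** Positions along the cycle turn adjacency into arithmetic: only positions 0, 1 and [#|H|.-1] are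
    not adjacent to [x]. *)
Lemma adj_iter x i : (i < #|H|)%N -> adj x (iter i s x) = (1 < i < #|H|.-1)%N.
Proof.
move=> iH; rewrite adjE -[s x]/(iter 1 s x) -[s (iter i s x)]/(iter i.+1 s x).
rewrite -[x in x != iter i s x]/(iter 0 s x) !iter_shift_eq ?iterS_shift_eq //; lia.
Qed.

Lemma adj_iter2 x i j : (i < j < #|H|)%N ->
  adj (iter i s x) (iter j s x) = (i.+1 < j < #|H|.-1 + i)%N.
Proof.
case/andP=> ij jH; rewrite -(subnK (ltnW ij)) iterD adj_iter; lia.
Qed.

Lemma IUC_card_nonstable (W : {set H}) x :
  IUC W -> x \in W -> s x \in W -> (#|W| <= 3)%N.
Proof.
move=> /IUCP WI xW sxW.
(* Every vertex beyond these two candidates is adjacent to both [x] and [s x], which are not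
   adjacent to each other. *)
pose y := if iter 2 s x \in W then iter 2 s x else iter #|H|.-1 s x.
suff WS : W \subset [:: x; s x; y].
  by apply: leq_trans (subset_leq_card WS) (card_size _).
have far i : (2 < i < #|H|.-1)%N -> iter i s x \notin W.
  move=> i2; apply/negP => iW.
  have := WI x (iter i s x) (iter 1 s x) xW iW sxW.
  rewrite (@adj_iter2 x 0 i) 1?adj_sym ?(@adj_iter2 x 1 i) ?(@adj_iter2 x 0 1) //; try lia.
  by rewrite (iter_shift_eq s_order x (i := 0)) //; lia.
apply/subsetP => z zW; have [i iH ez] := iter_shift_ex s_order x z.
rewrite !inE /y; move: zW; rewrite ez => iW.
have : (i < 3)%N || (i == #|H|.-1).
  by apply: contraLR iW => ?; apply: far; lia.
case/orP=> [|/eqP ei].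
  case: i iW {ez iH} => [|[|[|//]]] /= iW _; rewrite ?eqxx ?orbT //.
  by rewrite iW eqxx !orbT.
case: ifP => [ssxW|_]; last by rewrite ei eqxx !orbT.
rewrite ei in iW *.
(* The candidates exclude each other: [iter #|H|.-1 s x] is adjacent to both [s x] and [iter 2 s x],
   which are not adjacent. *)
have := WI (iter 1 s x) (iter #|H|.-1 s x) (iter 2 s x) sxW iW ssxW.
rewrite 1?(adj_sym (iter #|H|.-1 s x)) !adj_iter2 ?iter_shift_eq //; lia.
Qed.

Lemma IUC_stableP (W : {set H}) : IUC W ->
  (#|W| <= 3)%N \/ {in W, forall x, iter 1 s x \notin W}.
Proof.
move=> WI; have [W3|W3] := leqP #|W| 3; [by left|right=> x xW].
by apply/negP => /(IUC_card_nonstable WI xW); rewrite leqNgt W3.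
Qed.

(** As [6 <= #|H|], the bound 3 of the first case is at most [#|H| %/ 2]. *)
Lemma IUC_card (W : {set H}) : IUC W -> (#|W| <= #|H| %/ 2)%N.
Proof.
by move=> /IUC_stableP[|/(disjoint_shift_card s_inj)]; rewrite ?leq_divRL //; lia.
Qed.

(* In the complement of a hexagon, [x] and [iter 3 s x] are adjacent and every
   other vertex is adjacent to exactly one of them. *)
Lemma IUC_antipodal (W : {set H}) : #|H| = 6%N -> IUC W -> #|W| = 3%N ->
  {in W, forall x, iter 3 s x \notin W}.
Proof.
move=> HE /IUCP WI W3 x xW; apply/negP => x3W.
suff /subset_leq_card : W \subset [:: x; iter 3 s x].
  by move/leq_trans/(_ (card_size _)); rewrite W3.
apply/subsetP => z zW; have [i iH ez] := iter_shift_ex s_order x z.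
rewrite !inE; move: zW; rewrite ez => iW.
have A0 j : (j < 6)%N -> adj x (iter j s x) = (1 < j < 5)%N.
  by move=> ?; rewrite adj_iter HE.
have A3 j : (j < 6)%N -> adj (iter 3 s x) (iter j s x) = (j \in [:: 0; 1; 5])%N.
  move=> j6; have [->|j3] := eqVneq j 3%N; first by rewrite adj_irr.
  case: (ltngtP j 3%N) => [?|?|e]; last by rewrite e in j3.
    by rewrite adj_sym adj_iter2 HE ?inE; lia.
  by rewrite adj_iter2 HE ?inE; lia.
have E0 j : (j < 6)%N -> (x == iter j s x) = (j == 0)%N.
  by move=> ?; rewrite -[x in x == _]/(iter 0 s x) (iter_shift_eq s_order) ?HE // eq_sym.
have E3 j : (j < 6)%N -> (iter 3 s x == iter j s x) = (j == 3)%N.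
  by move=> ?; rewrite (iter_shift_eq s_order) ?HE // eq_sym.
rewrite HE in iH; rewrite ![iter i s x == _]eq_sym E0 // E3 //.
have := WI _ _ _ iW xW x3W; have := WI _ _ _ iW x3W xW.
rewrite (adj_sym (iter i s x) x) (adj_sym (iter i s x) (iter 3 s x)).
rewrite (adj_sym (iter 3 s x) x) ![iter i s x == _]eq_sym.
rewrite (A0 i iH) (A0 3%N isT).
rewrite (A3 i iH).
rewrite (E0 i iH) (E3 i iH) !inE.
move: iH; clear; case: i => [|[|[|[|[|[|]]]]]] //= _ h1 h2.
all: by [apply: h1 | apply: h2].
Qed.

Lemma IUC_polytope_valid : valid_ineq (IUC_polytope R H) (fun _ => 1) (#|H| %/ 2)%:R.
Proof.
apply: convex_hull_valid => _ [W WI ->].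
by rewrite dot1_incidence ler_nat IUC_card.
Qed.

Lemma sum_mem_eq (W : {set H}) x : \sum_(i in W) (i == x)%:R = (x \in W)%:R :> R.
Proof.
rewrite big_mkcond (bigD1 x) //= eqxx big1 => [|i /negPf ->]; last by case: ifP.
by rewrite addr0; case: ifP.
Qed.

(* When [#|H|] is even, a maximum stable set of the cycle contains exactly one
   vertex of each edge, hence contains [x] iff it contains [iter 2 s x]. For
   [#|H| = 6] the sets of three consecutive vertices also have maximum size; what
   both families share is meeting each antipodal pair exactly once. *)
Lemma IUC_even_face_functional : ~~ odd #|H| ->
  exists (f : H -> R) (u : H), f u != 0 /\
    forall W : {set H}, IUC W -> #|W| = (#|H| %/ 2)%N -> \sum_(i in W) f i = 0.
Proof.
move=> Hev.
have W2E (W : {set H}) : #|W| = (#|H| %/ 2)%N -> #|W|.*2 = #|H|.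
  by move=> ->; rewrite divn2 -[RHS]odd_double_half (negPf Hev).
have /card_gt0P[x _] : (0 < #|H|)%N by lia.
have nE i : (0 < i < #|H|)%N -> (x == iter i s x) = false.
  move=> iH; rewrite -[x in x == _]/(iter 0 s x) (iter_shift_eq s_order) //; lia.
have [HE|Hn6] := eqVneq #|H| 6%N.
  (* The difference of the indicators of two antipodal pairs. *)
  exists (fun y => (y == x)%:R + (y == iter 3 s x)%:R
    - ((y == iter 1 s x)%:R + (y == iter 4 s x)%:R)), x; split.
    by rewrite eqxx !nE ?HE // !addr0 subr0 oner_neq0.
  move=> W WI WE; rewrite !sumrB !big_split /= !sum_mem_eq.
  have W3 : #|W| = 3%N by rewrite WE HE.
  have opp y : (iter 3 s y \in W) = (y \notin W).
    by apply: disjoint_shift_half => //; [apply: IUC_antipodal | apply: W2E].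
  rewrite opp -[s (s (s (s x)))]/(iter 3 s (s x)) opp.
  by do 2!case: (_ \in W); rewrite ?addr0 ?add0r subrr.
exists (fun y => (y == x)%:R - (y == iter 2 s x)%:R), x; split.
  by rewrite eqxx nE ?subr0 ?oner_neq0 //; lia.
move=> W WI WE; rewrite sumrB !sum_mem_eq.
(* An even [#|H|] other than 6 is at least 8, so [W] has more than 3 elements. *)
have [W3|Ws] := IUC_stableP WI; first by have := W2E _ WE; lia.
have opp y : (iter 1 s y \in W) = (y \notin W).
  by apply: disjoint_shift_half => //; apply: W2E.
by rewrite -[iter 2 s x]/(iter 1 s (iter 1 s x)) !opp negbK subrr.
Qed.

(** A facet would contain [#|H|] affinely independent points. They are linearly independent, as the
    face avoids the origin, yet all lie in the kernel of a nonzero functional. *)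
Lemma IUC_even_not_facet : ~~ odd #|H| ->
  ~ facet_ineq (IUC_polytope R H) (fun _ => 1) (#|H| %/ 2)%:R.
Proof.
move=> Hev [_ [d [dimP [[p [pF pA]] _]]]].
have dH := has_dim_uniq dimP (IUC_polytope_dim R H).
have [f [u [fu f0]]] := IUC_even_face_functional Hev.
suff : (d.+1 < #|H|)%N by rewrite dH ltnn.
apply: (linearly_independent_ltn fu (p := p)).
  move=> i; have [] := pF i; apply: convex_hull_face.
    by move=> x Sx; apply: IUC_polytope_valid; apply: convex_hull_sub.
  move=> _ [W WI ->]; rewrite dot1_incidence dot_incidence => /eqP.
  by rewrite eqr_nat => /eqP; apply: f0.
apply: (affinely_independent_hyperplane (a := fun=> 1) (b := (#|H| %/ 2)%:R)) => //.
  by rewrite pnatr_eq0; lia.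
by move=> i; have [] := pF i.
Qed.

(* The stable set [{z, s^-2 z, s^-4 z, ...}] of size [#|H| %/ 2]. *)
Definition stride2 (z : H) : {set H} :=
  [set y | [exists j : 'I_(#|H| %/ 2), z == iter j.*2 s y]].

(** The vertices [iter j.*2 s y] are distinct for [j < #|H| %/ 2], so at most one term is
    nonzero. *)
Lemma stride2_sum (y z : H) :
  (y \in stride2 z)%:R = \sum_(j < #|H| %/ 2) (z == iter j.*2 s y)%:R :> R.
Proof.
have ltk (k : 'I_(#|H| %/ 2)) : (k.*2 < #|H|)%N by have := ltn_ord k; lia.
rewrite inE; case: existsP => [[j zj]|nz].
  rewrite (bigD1 j) //= zj big1 ?addr0 // => i ij.
  rewrite (eqP zj) (iter_shift_eq s_order) ?ltk //.
  by rewrite (inj_eq double_inj) eq_sym; have /= -> := negPf ij : (i == j :> nat) = false.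
by rewrite big1 // => j _; case: eqP => // e; case: nz; exists j; apply/eqP.
Qed.

(** Consecutive members would reach [z] from one vertex by both an even and an odd number of steps
    below [#|H|]. So all distinct members are adjacent. *)
Lemma stride2_IUC z : IUC (stride2 z).
Proof.
apply/IUCP => x t y; rewrite !inE => /existsP[i zx] _ /existsP[j zy] _ _ xy.
have odd_neq (k l : 'I_(#|H| %/ 2)) v : iter k.*2 s v != iter l.*2.+1 s v.
  by rewrite (iter_shift_eq s_order) //; have := ltn_ord k; have := ltn_ord l; lia.
rewrite adjE xy /=; apply/andP; split; apply/eqP => e.
  by have := odd_neq i j x; rewrite iterSr -e -(eqP zx) -(eqP zy) eqxx.
by have := odd_neq j i y; rewrite iterSr -e -(eqP zx) -(eqP zy) eqxx.
Qed.

(** Double counting: each [j] has exactly one [y] with [iter j.*2 s y = z]. *)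
Lemma stride2_card z : #|stride2 z| = (#|H| %/ 2)%N.
Proof.
apply/eqP; rewrite -(eqr_nat R) -dot1_incidence.
under eq_bigr do rewrite ffunE mul1r stride2_sum.
rewrite exchange_big /= -[X in _ == X%:R]card_ord -sumr_const; apply/eqP.
apply: eq_bigr => j _.
have [g gK Kg] := injF_bij (@iter_shift_inj _ _ s_inj j.*2).
rewrite (bigD1 (g z)) //= Kg eqxx big1 ?addr0 // => y yz.
by case: eqP => // e; case/eqP: yz; rewrite e gK.
Qed.

(* Writing [h y] for the sum of the [w (iter j.*2 s y)], [0 = h y - h (s (s y))]
   telescopes to [w y - w (iter #|H|.-1 s y)], so that [w] is constant. *)
Lemma stride2_independent (w : H -> R) : odd #|H| ->
  \sum_z w z *: incidence R (stride2 z) = 0 -> forall z, w z = 0.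
Proof.
move=> Hodd w0; set k := (#|H| %/ 2)%N.
have kE : #|H| = k.*2.+1.
  by rewrite -[LHS]odd_double_half Hodd /k divn2.
have h0 y : \sum_(j < k) w (iter j.*2 s y) = 0.
  have /ffunP/(_ y) := w0; rewrite sum_scale_ffunE ffunE; apply: etrans.
  under [RHS]eq_bigr do rewrite ffunE stride2_sum mulr_sumr.
  rewrite exchange_big /=; apply: eq_bigr => j _.
  rewrite (bigD1 (iter j.*2 s y)) //= eqxx mulr1 big1 ?addr0 // => z /negPf ->.
  by rewrite mulr0.
have ws y : w (s y) = w y.
  (* By [h0], this sum reduces to its last term, which is [w y], and also to its first term,
     [w (s y)]. *)
  have : \sum_(j < k.+1) w (iter j.*2 s (s y)) = w (iter k.*2 s (s y)).
    by rewrite big_ord_recr /= h0 add0r.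
  rewrite -iterSr -kE (iter_shift_card s_inj s_order) => <-.
  rewrite big_ord_recl -[LHS]addr0; congr (_ + _).
  rewrite -[LHS](h0 (iter 2 s (s y))); apply: eq_bigr => j _.
  by rewrite -iterD lift0 doubleS addn2.
move=> z; apply/eqP; have /eqP := h0 z.
have wi i : w (iter i s z) = w z by elim: i => //= i IHi; rewrite ws.
under eq_bigr do rewrite wi.
by rewrite sumr_const card_ord mulrn_eq0 => /orP[|//]; lia.
Qed.

(** The sets [stride2 z] supply [#|H|] independent points of the face; no more fit, because the face
    lies in a hyperplane off the origin. *)
Lemma IUC_odd_facet : odd #|H| ->
  facet_ineq (IUC_polytope R H) (fun _ => 1) (#|H| %/ 2)%:R.
Proof.
move=> Hodd; split; first exact: IUC_polytope_valid.
have HE : #|H|.-1.+1 = #|H| by rewrite prednK //; lia.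
exists #|H|.-1; split; first by rewrite HE; apply: IUC_polytope_dim.
set F := fun x => _; split.
  apply: (affinely_independent_ord (S := F) (q := fun z => incidence R (stride2 z))).
  - by rewrite HE.
  - move=> z; split; last by rewrite dot1_incidence stride2_card.
    by apply: convex_hull_sub; exists (stride2 z) => //; apply: stride2_IUC.
  - by move=> w _; apply: stride2_independent.
move=> m p pF pA; rewrite HE; apply: (@linearly_independent_leq R _ _ p).
apply: (affinely_independent_hyperplane (a := fun=> 1) (b := (#|H| %/ 2)%:R)) => //.
  by rewrite pnatr_eq0; lia.
by move=> i; have [] := pF i.
Qed.

End CyclicComplement.

(** * From anti-holes to cyclic shifts *)

Section Antihole.
Variables (G : sgraph) (A : {set G}).

Lemma card_induced : #|induced A| = #|A|.
Proof. by rewrite card_sub; apply: eq_card => x; rewrite inE. Qed.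

(** Take [s] to be [next c] for the complement cycle [c]; absence of chords means that only
    consecutive vertices are non-adjacent in [induced A]. *)
Lemma antihole_shift : antihole A ->
  exists s : induced A -> induced A,
    [/\ injective s, forall x, order s x = #|induced A| &
        forall x y : induced A, adj x y = [&& x != y, y != s x & x != s y]].
Proof.
case=> _ [c [c3 /andP[cC cU] cT cN]]; exists (next c).
have cE : #|induced A| = size c.
  by rewrite -(card_uniqP cU); apply: eq_card => x; rewrite cT.
split=> [|x|x y]; first exact: can_inj (prev_next cU).
  by rewrite cE (order_cycle (cycle_next cU) cU (cT x)).
have nN (z : induced A) : ~~ adj z (next c z) by have /andP[] := next_cycle cC (cT z).
have [->|xy] := eqVneq x y; first by rewrite adj_irr.
apply/idP/and3P => [xyA|[_ xs ys]].
  split=> //; apply/eqP => e; move: xyA; rewrite e; first exact/negP/nN.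
  by rewrite adj_sym; apply/negP/nN.
apply: contraT => xyN; have [|e|e] := cN x y; first by rewrite /= /compl_adj xy.
  by rewrite e eqxx in xs.
by rewrite e eqxx in ys.
Qed.

Lemma IUC_induced (U : {set G}) : IUC U -> IUC ([set x | val x \in U] : {set induced A}).
Proof.
move=> /IUCP UI; apply/IUCP => x y z; rewrite !inE => xU yU zU xy yz xz.
exact: UI _ _ _ xU yU zU xy yz xz.
Qed.

Lemma card_induced_set (U : {set G}) :
  #|[set x : induced A | val x \in U]| = #|A :&: U|.
Proof.
rewrite -(card_imset _ val_inj); apply: eq_card => x; rewrite !inE.
apply/imsetP/andP => [[y yU ->]|[xA xU]]; first by rewrite inE in yU; split=> //; apply: valP.
by exists (exist _ x xA); rewrite ?inE.
Qed.

End Antihole.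

Unset Implicit Arguments.

Theorem theorem5 (R : realFieldType) (G : sgraph) (A : {set G})
    (hA : antihole A) (hA6 : (6 <= #|A|)%N) :
  (forall x : {ffun G -> R^o}, IUC_polytope R G x ->
     \sum_(i in A) (x i : R) <= (#|A| %/ 2)%:R) /\
  (facet_ineq (IUC_polytope R (induced A)) (fun _ => 1)
     (#|A| %/ 2)%:R
   <-> odd #|A|).
Proof.
have [s [s_inj s_order adjE]] := antihole_shift hA.
have H6 : (6 <= #|induced A|)%N by rewrite card_induced.
split=> [x xP|]; rewrite -card_induced; last first.
  split=> [|Aodd]; last exact: IUC_odd_facet s_inj s_order adjE H6 Aodd.
  by apply: contraPT => Aev; apply: IUC_even_not_facet s_inj s_order adjE H6 Aev.
pose a i : R := (i \in A)%:R.
have -> : \sum_(i in A) (x i : R) = \sum_i a i * x i.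
  rewrite big_mkcond; apply: eq_bigr => i _.
  by rewrite /a; case: ifP; rewrite ?mul1r ?mul0r.
(* It suffices to bound each IUC [U] of [G], whose trace on [A] is an IUC of [induced A]. *)
apply: convex_hull_valid xP => _ [U UI ->].
have -> : \sum_i a i * incidence R U i = #|A :&: U|%:R.
  rewrite -sumr_const [RHS]big_mkcond; apply: eq_bigr => i _.
  by rewrite /a ffunE -natrM mulnb inE; case: andP.
by rewrite ler_nat -card_induced_set (IUC_card s_inj) //; apply: IUC_induced.
Qed.
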